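(* For each $n$ let $\boldsymbol{d}_n\in\mathbb{N}^n$ be a degree vector (all entries $\ge1$, sum even) and let $G_n=\mathrm{CM}_n(\boldsymbol{d}_n)$ be the undirected configuration model. Let $\phi_n$ be a uniformly chosen vertex of $[n]$ and $D_n=d_{\phi_n}$. Assume $D_n\to D$ in distribution and $\mathbb{E}[D_n]\to\mathbb{E}[D]<\infty$. Let $c\in(0,1)$ and let $\boldsymbol{R}^{(G_n)}$ be the PageRank vector of $G_n$ with damping factor $c$. Then for all $n,k$, $$\mathbb{P}(R^{(G_n)}_{\phi_n}>k)\le\mathbb{P}(D_n>k),$$ and for any $\beta>\frac{4\mathbb{E}[D]}{c(1-c)}$, $$\liminf_{k\to\infty}\liminf_{n\to\infty}\frac{\mathbb{P}(R^{(G_n)}_{\phi_n}>k)}{\mathbb{P}(D_n>\beta k)}\ge1.$$ Moreover, if $D$ has a power-law distribution with exponent $\tau>1$ and tail function $\mathcal{L}$, then there is $0<\underline a\le1$ such that the limiting root-PageRank $R_\phi$ satisfies $$\underline a\,\mathcal{L}(k)k^{-(\tau-1)}\le\mathbb{P}(R_\phi>k)\le\mathcal{L}(k)k^{-(\tau-1)}\qquad\text{for every }k\in(0,\infty).$$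
   Context: $\mathrm{CM}_n(\boldsymbol{d})$: vertex $i\in[n]$ receives $d_i$ half-edges; a uniformly random perfect matching of all $|\boldsymbol{d}|=\sum_id_i$ half-edges (via a uniform permutation) is formed and matched half-edges become edges. PageRank on a finite graph: with $p_{ij}=a_{ij}/d_i$ ($a_{ij}$ the adjacency entries), $\boldsymbol{R}$ is the unique solution of $\boldsymbol{R}=c\boldsymbol{R}\boldsymbol{P}+(1-c)\boldsymbol{1}_n$, i.e. $R_k=(1-c)\sum_{s\ge0}c^s\sum_j(\boldsymbol{P}^s)_{jk}$. Probabilities are over both the random graph and the uniform root. The limiting root-PageRank $R_\phi$ is the root-PageRank $R_\phi=(1-c)\sum_{s\ge0}c^s\sum_j(\boldsymbol{P}^s)_{j\phi}$ of the unimodular branching-process tree with root-degree distribution $p_k=\mathbb{P}(D=k)$ (the root has $D$ children, every other vertex has an independent number of children with law $p^*_k=(k+1)p_{k+1}/\mathbb{E}[D]$), which is the local weak limit of $G_n$; equivalently $R_\phi$ is the distributional limit of $R^{(G_n)}_{\phi_n}$. A function $\mathcal{L}:(0,\infty)\to(0,\infty)$ is slowly varying if $\mathcal{L}(ax)/\mathcal{L}(x)\to1$ as $x\to\infty$ for every $a>0$; $X$ has a power-law distribution with exponent $\tau>1$ and tail function $\mathcal{L}$ if $\mathcal{L}$ is slowly varying and $\mathbb{P}(X>x)=\mathcal{L}(x)x^{-(\tau-1)}$ for all $x>0$. *)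

(* Defs.v *)
From HB Require Import structures.
From mathcomp Require Import all_boot all_order all_algebra all_fingroup.
From mathcomp Require Import all_classical all_reals all_analysis.
Set Implicit Arguments. Unset Strict Implicit. Unset Printing Implicit Defensive.
Import Order.TTheory GRing.Theory Num.Theory numFieldNormedType.Exports.
Local Open Scope classical_set_scope.
Local Open Scope ring_scope.

Section ConfigurationModel.
Variable R : realType.

(* half-edges are 0, ..., |d|-1; vertex i owns the block
   [offs i, offs (i+1)) where offs i = sum_{j<i} d_j *)
Definition offs n (d : 'I_n -> nat) (i : nat) : nat := (\sum_(j < n | (j < i)%N) d j)%N.
Definition owner n (d : 'I_n -> nat) (h : nat) : nat := #|[set j : 'I_n | (offs d j.+1 <= h)%N]|.
Definition nhalf n (d : 'I_n -> nat) : nat := (\sum_(i < n) d i)%N.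
(* a uniform permutation sigma of the half-edges lists them in a row;
   positions 2i and 2i+1 are matched *)
Definition hseq n (d : 'I_n -> nat) (s : {perm 'I_(nhalf d)}) : seq nat :=
  [seq nat_of_ord (s i) | i <- enum 'I_(nhalf d)].
Definition mate n (d : 'I_n -> nat) (s : {perm 'I_(nhalf d)}) (h : nat) : nat :=
  let p := index h (hseq s) in nth 0%N (hseq s) (if odd p then p.-1 else p.+1).
(* adjacency entries a_ij = number of half-edges of i matched to a half-edge
   of j (a self-loop contributes 2 to a_ii), so that sum_j a_ij = d_i *)
Definition adj n (d : 'I_n -> nat) (s : {perm 'I_(nhalf d)}) (i j : 'I_n) : nat :=
  #|[set h : 'I_(nhalf d) | (owner d h == i) && (owner d (mate s h) == j)]|.
Definition transP n (d : 'I_n -> nat) (s : {perm 'I_(nhalf d)}) : 'M[R]_n :=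
  \matrix_(i, j) ((adj s i j)%:R / (d i)%:R).
(* PageRank: the unique solution of R = c R P + (1-c) 1 *)
Definition pagerank n (d : 'I_n -> nat) (c : R) (s : {perm 'I_(nhalf d)}) : 'rV[R]_n :=
  (1 - c) *: (const_mx 1 *m invmx (1%:M - c *: transP s)).

Definition probPR n (d : 'I_n -> nat) (c k : R) : R :=
  (\sum_(s : {perm 'I_(nhalf d)}) \sum_(v : 'I_n)
     (if k < pagerank c s 0 v then 1 else 0))
  / (#|{perm 'I_(nhalf d)}| * n)%:R.
Definition probDeg n (d : 'I_n -> nat) (k : R) : R :=
  #|[set i : 'I_n | k < (d i)%:R]|%:R / n%:R.
Definition pmfDeg n (d : 'I_n -> nat) (k : nat) : R :=
  #|[set i : 'I_n | d i == k]|%:R / n%:R.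
Definition meanDeg n (d : 'I_n -> nat) : R := (nhalf d)%:R / n%:R.

(* Ulam-Harris labels, most recent step first: the children of v are i :: v
   for i < X v, the parent of i :: v is v; X v is the number of children. *)
Definition tdeg (X : seq nat -> nat) (v : seq nat) : nat :=
  if v is [::] then X v else (X v).+1.
(* walkw X s v = sum_j (P^s)_{j v} *)
Fixpoint walkw (X : seq nat -> nat) (s : nat) (v : seq nat) : R :=
  match s with
  | 0 => 1
  | s'.+1 =>
      \sum_(i < X v) walkw X s' (nat_of_ord i :: v) / (tdeg X (nat_of_ord i :: v))%:R
      + (if v is _ :: v' then walkw X s' v' / (tdeg X v')%:R else 0)
  end.
Definition rootPR (X : seq nat -> nat) (c : R) : \bar R :=
  (\sum_(0 <= s <oo) ((1 - c) * c ^+ s * walkw X s [::])%:E)%E.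

Definition indep_nat (d : measure_display) (T : measurableType d)
  (P : probability T R) (X : seq nat -> T -> nat) : Prop :=
  forall (us : seq (seq nat)) (ks : seq nat -> nat), uniq us ->
    P (\big[setI/setT]_(u <- us) (X u @^-1` [set ks u])) =
    (\prod_(u <- us) P (X u @^-1` [set ks u]))%E.

Definition UBP_tree (d : measure_display) (T : measurableType d)
  (P : probability T R) (X : seq nat -> T -> nat) (p : nat -> R) (ED : R) : Prop :=
  [/\ forall u k, measurable (X u @^-1` [set k]),
      forall k, P (X [::] @^-1` [set k]) = (p k)%:E,
      forall u k, u != [::] ->
        P (X u @^-1` [set k]) = ((k.+1)%:R * p k.+1 / ED)%:E
    & indep_nat P X].

Definition slowly_varying (L : R -> R) : Prop :=
  (forall x, 0 < x -> 0 < L x) /\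
  forall a, 0 < a -> (fun x => L (a * x) / L x) x @[x --> +oo] --> (1 : R).

End ConfigurationModel.

(* Main.v *)
Require Import Defs.
From HB Require Import structures.
From mathcomp Require Import all_boot all_order all_algebra all_fingroup.
From mathcomp Require Import all_classical all_reals all_analysis.
From mathcomp Require Import measurable_realfun.
From mathcomp Require Import ring lra zify.
Set Implicit Arguments. Unset Strict Implicit. Unset Printing Implicit Defensive.
Import Order.TTheory GRing.Theory Num.Theory numFieldNormedType.Exports.
Local Open Scope ring_scope.

(** The degree vector is stationary for the undirected walk and dominates the
   constant vector 1, so a minimum principle for [x = c x P + y] gives
   [R_v <= d_v]; on the tree the same domination is an induction along walks.

   For the lower bound keep only the walks of length one:
   [R_v >= c (1 - c) S_v], where [S_v] sums [1 / d_u] over the neighbours [u]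
   of [v]. Averaged over all half-edges, [1 / d_u] equals [n / l], with [l] the
   number of half-edges. A second moment computation over the random pairing
   shows that, for [d_v] large, [S_v] is at least half its mean
   [d_v n / l ~ d_v / E[D]] with high probability; one more factor 2 absorbs
   the convergence of [l / n] to [E[D]]. The estimate is uniform in the root, so
   no control of the largest degree is needed.

   On the tree the constant is not specified, so a first moment suffices: fix
   [j] with [p_{j+1} > 0] and count the children of the root of degree [j + 1].
   Given [D = m] their mean number is [q m], so with probability at least [q / 2]
   there are more than [q m / 2] of them, whence
   [P(R > k) >= q / 2 P(D > b k)] for every [k]. Slow variation
   compares the two tails. *)

Lemma card_classical (T : finType) (b : pred T) :
  #|[set x | b x]%classic| = #|b|.
Proof.
by apply: eq_card => x; apply/idP/idP; rewrite inE.
Qed.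

(* Compare [x] with [w] at an index minimising [x j / w j]. *)
Lemma min_principle (R : realFieldType) (n : nat) (P : 'M[R]_n) (w x : 'rV[R]_n)
    (c : R) :
  0 <= c < 1 -> (forall i j, 0 <= P i j) -> (forall j, 0 < w 0 j) ->
  (forall j, (w *m P) 0 j <= w 0 j) ->
  (forall j, 0 <= (x *m (1%:M - c *: P)) 0 j) -> forall j, 0 <= x 0 j.
Proof.
move=> /andP[c0 c1] P0 w0 wP xP j.
have [i _ imin] := @Order.TotalTheory.arg_minP _ _ _ j xpredT (fun i => x 0 i / w 0 i) isT.
set m := x 0 i / w 0 i in imin.
have xm k : m * w 0 k <= x 0 k by rewrite -ler_pdivlMr //; exact: imin.
suff m0 : 0 <= m by apply: le_trans (xm j); rewrite mulr_ge0 // ltW.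
rewrite leNgt; apply/negP => mlt0.
have xi : x 0 i = m * w 0 i by rewrite /m divfK // gt_eqF.
have := xP i; rewrite mulmxBr mulmx1 -scalemxAr !mxE subr_ge0 xi => h.
(* Multiplying [w P <= w] by [m < 0] reverses it, while [x >= m w] holds in every coordinate. With
   [h] this gives [c * (m w_i) <= m w_i < 0], impossible for [c < 1]. *)
have h2 : m * w 0 i <= \sum_k x 0 k * P k i.
  apply: (@le_trans _ _ (m * (w *m P) 0 i)).
    by rewrite ler_wnM2l // ltW.
  rewrite mxE mulr_sumr; apply: ler_sum => k _.
  by rewrite mulrA ler_wpM2r.
have h3 : c * (m * w 0 i) <= m * w 0 i by apply: le_trans h; rewrite ler_wpM2l.
have mw : m * w 0 i < 0 by rewrite pmulr_llt0.
nra.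
Qed.

(** * Blocks of half-edges and the matching as an involution *)

Section HalfEdges.
Variables (n : nat) (d : 'I_n -> nat).
Local Notation l := (nhalf d).

Lemma offs_mono i j : (i <= j)%N -> (offs d i <= offs d j)%N.
Proof.
move=> ij; rewrite /offs [leqRHS]big_mkcond [leqLHS]big_mkcond /=.
by apply: leq_sum => k _; case: (ltnP k i) => // ki; rewrite (leq_trans ki ij).
Qed.

Lemma offsS (i : 'I_n) : offs d i.+1 = (offs d i + d i)%N.
Proof.
rewrite /offs (bigD1 i) //= addnC; congr (_ + _)%N; apply: eq_bigl => j.
by rewrite ltnS [RHS]ltn_neqAle andbC.
Qed.

Lemma offs0 : offs d 0 = 0%N.
Proof. by rewrite /offs big_pred0. Qed.

Lemma offs_max : offs d n = l.
Proof. by rewrite /offs /nhalf; apply: eq_bigl => j; rewrite ltn_ord. Qed.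

(** [owner] counts the vertices whose block ends at or before [h]; by monotonicity of [offs] these
    are exactly the [j < i]. *)
Lemma ownerP (h : nat) (i : 'I_n) :
  (offs d i <= h < offs d i.+1)%N -> owner d h = i.
Proof.
move=> /andP[ih hi]; rewrite /owner card_classical.
transitivity #|[pred j : 'I_n | (j < i)%N]|.
  apply: eq_card => j; rewrite !unfold_in /=; case: (ltnP j i) => ji.
    by apply: leq_trans ih; exact: offs_mono.
  by apply/negbTE; rewrite -ltnNge; apply: leq_trans hi _; exact: offs_mono.
transitivity (\sum_(j < i) 1)%N; last by rewrite sum1_card card_ord.
by rewrite (big_ord_widen n (fun=> 1%N)) ?sum1_card // ltnW.
Qed.

Lemma owner_exists (h : nat) : (h < l)%N ->
  exists i : 'I_n, (offs d i <= h < offs d i.+1)%N.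
Proof.
rewrite -offs_max => hl.
have ex : exists k, (h < offs d k)%N by exists n.
case: (ex_minnP ex) => [[|k] hk kmin]; first by rewrite offs0 in hk.
have kn : (k < n)%N by exact: kmin.
exists (Ordinal kn); rewrite /= hk andbT leqNgt; apply/negP => /kmin.
by rewrite ltnn.
Qed.

Lemma owner_lt (h : 'I_l) : (owner d h < n)%N.
Proof. by have [i /ownerP ->] := owner_exists (ltn_ord h). Qed.

Definition own (h : 'I_l) : 'I_n := Ordinal (owner_lt h).

Lemma card_own (i : 'I_n) : #|[pred h | own h == i]| = d i.
Proof.
have oi : (offs d i.+1 <= l)%N by rewrite -offs_max offs_mono.
transitivity #|[pred h : 'I_l | (offs d i <= h < offs d i.+1)%N]|.
  apply: eq_card => h; rewrite !unfold_in /= -val_eqE /=; apply/eqP/idP.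
    have [j hj] := owner_exists (ltn_ord h).
    by rewrite (ownerP hj) => /val_inj <-.
  by move/ownerP.
rewrite -sum1_card.
transitivity (\sum_(0 <= h < l | (offs d i <= h)%N && (h < offs d i.+1)%N) 1)%N.
  by rewrite big_mkord.
rewrite -big_nat_widen // -(big_nat_widenl _ _ _ xpredT) //.
by rewrite sum_nat_const_nat muln1 offsS addKn.
Qed.

Lemma sum_own (V : nmodType) (F : 'I_n -> V) :
  \sum_(h : 'I_l) F (own h) = \sum_i F i *+ d i.
Proof.
rewrite (partition_big own xpredT) //=; apply: eq_bigr => i _.
rewrite (eq_bigr (fun=> F i)) => [|h /eqP -> //].
by rewrite sumr_const -card_own.
Qed.

Hypothesis l_even : ~~ odd l.

(** Evenness of [l] keeps the successor of an even position in range. *)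
Lemma flip_subproof (p : 'I_l) : ((if odd p then p.-1 else p.+1) < l)%N.
Proof. have := ltn_ord p; case: ifP => op pl; first by lia. by lia. Qed.

Definition flip (p : 'I_l) : 'I_l := Ordinal (flip_subproof p).

Lemma flipK : involutive flip.
Proof. by move=> p; apply: val_inj => /=; case: (boolP (odd p)) => op; case: ifP; lia. Qed.

Lemma flip_neq p : flip p != p.
Proof. by rewrite -val_eqE /=; case: ifP; lia. Qed.

(** Replaces the list lookup by the conjugate of [flip] by [s], which makes the group structure
    available. *)
Lemma mateE (s : {perm 'I_l}) (h : 'I_l) : mate s h = s (flip ((s^-1)%g h)).
Proof.
rewrite /mate; have ix : index (h : nat) (hseq s) = (s^-1)%g h.
  rewrite -[in LHS](permKV s h) /hseq.
  rewrite (index_map (f := fun i => nat_of_ord (s i))).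
    by rewrite index_enum_ord.
  by move=> i j /val_inj /perm_inj.
(* The default values of [nth] are never reached, since the flipped position is below the size of
   the list. *)
rewrite ix /hseq (nth_map h); last by rewrite size_enum_ord; exact: (flip_subproof ((s^-1)%g h)).
congr (nat_of_ord (s _)); apply: val_inj.
by rewrite /= nth_enum_ord //; exact: (flip_subproof ((s^-1)%g h)).
Qed.

End HalfEdges.

(** * PageRank of the pairing *)

Section PageRankBounds.
Variables (R : realType) (n : nat) (d : 'I_n -> nat) (c : R).
Local Notation l := (nhalf d).
Hypotheses (d_gt0 : forall i, (0 < d i)%N) (l_even : ~~ odd l) (c01 : 0 < c < 1).

Implicit Types (s : {perm 'I_l}) (i j v : 'I_n) (h : 'I_l).

Definition partner (s : {perm 'I_l}) (h : 'I_l) : 'I_l :=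
  s (flip l_even ((s^-1)%g h)).

Lemma partnerK s : involutive (partner s).
Proof. by move=> h; rewrite /partner permK flipK permKV. Qed.

Lemma adjE s i j :
  adj s i j = (\sum_(h : 'I_l | (own h == i) && (own (partner s h) == j)) 1)%N.
Proof.
rewrite /adj card_classical sum1_card; apply: eq_card => h.
by rewrite !unfold_in /= -!val_eqE /= (mateE l_even).
Qed.

(** Reindexing by the involution [partner s] swaps the two ends of every edge, so the column sum
    counts the half-edges of [j]. *)
Lemma sum_adjl s j : (\sum_i adj s i j)%N = d j.
Proof.
rewrite -(card_own d j) -sum1_card [RHS](reindex_inj (inv_inj (partnerK s))) /=.
rewrite [RHS](partition_big (@own n d) xpredT) //=; apply: eq_bigr => i _.
by rewrite adjE; apply: eq_bigl => h; rewrite unfold_in /= andbC.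
Qed.

Let A (s : {perm 'I_l}) : 'M[R]_n := 1%:M - c *: transP R s.
Let w : 'rV[R]_n := \row_j (d j)%:R.

Let c0 : 0 <= c < 1. Proof. by have /andP[/ltW -> ->] := c01. Qed.

Let P_ge0 (s : {perm 'I_l}) i j : 0 <= transP R s i j.
Proof. by rewrite mxE divr_ge0. Qed.

Let w_gt0 j : 0 < w 0 j. Proof. by rewrite mxE ltr0n. Qed.

Lemma deg_stationary s : w *m transP R s = w.
Proof.
apply/rowP => j; rewrite !mxE -[in RHS](sum_adjl s) natr_sum.
apply: eq_bigr => i _; rewrite !mxE mulrC divfK //.
by rewrite pnatr_eq0 -lt0n.
Qed.

Let minp (s : {perm 'I_l}) (x : 'rV[R]_n) : (forall j, 0 <= (x *m A s) 0 j) -> forall j, 0 <= x 0 j.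
Proof.
by move=> h; apply: (min_principle c0 (P_ge0 s) w_gt0) => // j; rewrite deg_stationary.
Qed.

(** The minimum principle applies to a kernel vector and to its negative, so the vector vanishes.
    Hence [invmx] in [pagerank] is a genuine inverse. *)
Lemma pagerank_unit s : A s \in unitmx.
Proof.
rewrite -row_free_unit; apply: inj_row_free => x xA.
apply/rowP => j; rewrite mxE; apply/le_anti/andP; split; last first.
  by apply: (@minp s x) => k; rewrite xA mxE.
have := @minp s (- x); rewrite mulNmx xA oppr0 => /(_ _ j).
by rewrite [(- x) 0 j]mxE oppr_ge0; apply=> k; rewrite mxE.
Qed.

Lemma pagerankE s : pagerank c s *m A s = (1 - c) *: const_mx 1.
Proof. by rewrite /pagerank -scalemxAl mulmxKV // pagerank_unit. Qed.

Lemma pagerank_rec s v : pagerank c s 0 v =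
  (1 - c) + c * \sum_i pagerank c s 0 i * ((adj s i v)%:R / (d i)%:R).
Proof.
have /rowP/(_ v) := pagerankE s.
rewrite /A mulmxBr mulmx1 -scalemxAr !mxE mulr1 => /eqP; rewrite subr_eq => /eqP ->.
congr (_ + _ * _).
by apply: eq_bigr => i _; rewrite [transP _ _ _ _]mxE.
Qed.

(** Apply the minimum principle to [w - pagerank c s]: by stationarity its image under [A s] has
    entries [(1 - c) * (d j - 1) >= 0]. *)
Lemma pagerank_le_deg s v : pagerank c s 0 v <= (d v)%:R.
Proof.
have := @minp s (w - pagerank c s).
rewrite mulmxBl pagerankE /A mulmxBr mulmx1 -scalemxAr deg_stationary => /(_ _ v).
rewrite !mxE subr_ge0; apply => j; rewrite !mxE mulr1.
have dj : (1 : R) <= (d j)%:R by rewrite ler1n.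
have /andP[? ?] := c01; nra.
Qed.

Lemma pagerank_ge s v : 1 - c <= pagerank c s 0 v.
Proof.
have p0 i : 0 <= pagerank c s 0 i.
  apply: (@minp s (pagerank c s)) => j; rewrite pagerankE !mxE mulr1.
  by have /andP[_ /ltW ?] := c01; rewrite subr_ge0.
rewrite pagerank_rec lerDl mulr_ge0 //; first by case/andP: c0.
by apply: sumr_ge0 => i _; rewrite mulr_ge0 // divr_ge0.
Qed.

(** One use of the recursion, with [1 - c] as lower bound for the PageRank of each neighbour. *)
Lemma pagerank_ge_neighbours s v :
  c * (1 - c) * \sum_(h | own h == v) (d (own (partner s h)))%:R^-1
    <= pagerank c s 0 v.
Proof.
have /andP[c_gt0 c_lt1] := c01.
have -> : \sum_(h | own h == v) ((d (own (partner s h)))%:R : R)^-1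
        = \sum_i (adj s i v)%:R / (d i)%:R.
  rewrite (partition_big (fun h => own (partner s h)) xpredT) //=.
  apply: eq_bigr => i _; rewrite (eq_bigr (fun=> (d i)%:R^-1)) => [|h /andP[_ /eqP ->] //].
  rewrite sumr_const mulrC -[LHS]mulr_natr; congr (_ * _%:R).
  rewrite adjE (reindex_inj (inv_inj (partnerK s))) /= -sum1_card.
  by apply: eq_bigl => h; rewrite partnerK unfold_in /= andbC.
rewrite pagerank_rec -mulrA -[leLHS]add0r; apply: lerD; first by rewrite subr_ge0 ltW.
rewrite ler_pM2l // mulr_sumr.
by apply: ler_sum => i _; rewrite ler_wpM2r ?divr_ge0 // pagerank_ge.
Qed.

Lemma probDegE (k : R) : probDeg d k = (\sum_(v : 'I_n) (if k < (d v)%:R then 1 else 0)) / n%:R.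
Proof.
by rewrite /probDeg card_classical -sum1_card natr_sum -big_mkcond.
Qed.

(** The degree bound holds for every pairing, so averaging preserves it; for [n = 0] both sides are
    0. *)
Lemma probPR_le_probDeg (k : R) : probPR d c k <= probDeg d k.
Proof.
rewrite probDegE /probPR natrM invfM mulrA ler_wpM2r ?invr_ge0 //.
rewrite ler_pdivrMr; last by rewrite ltr0n (cardD1 1%g).
rewrite mulr_natr -sumr_const; apply: ler_sum => s _; apply: ler_sum => v _.
case: ifP => [kp|_]; first by rewrite (lt_le_trans kp) // pagerank_le_deg.
by case: ifP.
Qed.

End PageRankBounds.

(** * Moments of the pairing *)

(* With [x] half-edges in total and [F] the sum of the weights, this is the
   excess, relative to [m ^+ 2], of the second moment over independent sampling. *)
Lemma variance_error_le (R : realFieldType) (x F : R) :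
  10 <= x -> 0 <= F <= x ->
  (x - 1)^-1 + F ^+ 2 / ((x - 2) * (x - 3)) - (F / (x - 1)) ^+ 2
    + 2 * F / (x - 1) ^+ 2 <= 20 / x.
Proof.
move=> x10 /andP[F0 Fx].
have p1 : 0 < (x - 1) ^+ 2 by rewrite exprn_gt0; lra.
have p2 : 0 < (x - 2) * (x - 3) by rewrite mulr_gt0; lra.
(* The factors [81/100] and [56/100] are the ratios at [x = 10]. The bounds [k1], [k2], [k3] below
   then spend 2, 8 and 10 of the constant 20. *)
have q1 : x ^+ 2 * (81/100) <= (x - 1) ^+ 2 by nra.
have q2 : x ^+ 2 * (56/100) <= (x - 2) * (x - 3) by nra.
have k1 : (x - 1)^-1 <= 2 / x.
  rewrite -subr_ge0; have -> : 2 / x - (x - 1)^-1 = (x - 2) / (x * (x - 1)) by field; lra.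
  by rewrite divr_ge0 ?mulr_ge0; lra.
have k2 : 2 * F / (x - 1) ^+ 2 <= 8 / x.
  rewrite ler_pdivrMr // mulrAC ler_pdivlMr; last lra.
  have : 2 * F * x <= 2 * x * x by rewrite ler_wpM2r; lra.
  by lra.
have k3 : F ^+ 2 / ((x - 2) * (x - 3)) - (F / (x - 1)) ^+ 2 <= 10 / x.
  have -> : F ^+ 2 / ((x - 2) * (x - 3)) - (F / (x - 1)) ^+ 2 =
     F ^+ 2 * ((3 * x - 5) / ((x - 1) ^+ 2 * ((x - 2) * (x - 3)))).
    by field; lra.
  apply: (@le_trans _ _ (x ^+ 2 * ((3 * x - 5) / ((x - 1) ^+ 2 * ((x - 2) * (x - 3)))))).
    rewrite ler_wpM2r //; last by rewrite ler_sqr ?nnegrE //; lra.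
    by rewrite divr_ge0 ?mulr_ge0 ?sqr_ge0; lra.
  have q3 : x ^+ 2 * (81/100) * (x ^+ 2 * (56/100)) <= (x - 1) ^+ 2 * ((x - 2) * (x - 3)).
    have x20 : 0 <= x ^+ 2 by exact: sqr_ge0.
    by apply: ler_pM => //; lra.
  have pp := mulr_gt0 p1 p2.
  rewrite mulrA ler_pdivrMr; last exact: pp.
  rewrite [leRHS]mulrAC ler_pdivlMr; last lra.
  have x4 : 0 <= x ^+ 4 by rewrite exprn_ge0; lra.
  have x3 : 0 <= x ^+ 3 by rewrite exprn_ge0; lra.
  have x2 : 0 <= x ^+ 2 by exact: sqr_ge0.
  have e1 : x ^+ 2 * (3 * x - 5) * x <= 3 * x ^+ 4 by lra.
  have e2 : x ^+ 2 * (81/100) * (x ^+ 2 * (56/100)) = 4536/10000 * x ^+ 4 by field.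
  by lra.
by lra.
Qed.

(** * Counting pairings with one or two prescribed edges *)

Section PairingCounts.
Variables (n : nat) (d : 'I_n -> nat).
Local Notation l := (nhalf d).
Hypothesis l_even : ~~ odd l.
Local Notation N := #|{perm 'I_l}|.
Local Notation mt := (partner l_even).
Implicit Types (s t : {perm 'I_l}) (g h a b : 'I_l).

Lemma partner_neq s h : mt s h != h.
Proof.
rewrite /partner -{2}(permKV s h) (inj_eq perm_inj); exact: flip_neq.
Qed.

(** Relabelling half-edges by [t] transports the pairing; right multiplication by a suitable [t]
    then gives bijections between events. *)
Lemma partner_conj s t h : mt (s * t)%g (t h) = t (mt s h).
Proof. by rewrite /partner invMg !permM permK. Qed.

Lemma card_partner_sym h a b : a != h -> b != h ->
  #|[pred s | mt s h == a]| = #|[pred s | mt s h == b]|.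
Proof.
move=> ah bh; rewrite -!sum1_card (reindex_inj (mulIg (tperm a b))) /=.
apply: eq_bigl => s; rewrite !unfold_in /=.
have {1}-> : h = tperm a b h by rewrite tpermD.
by rewrite partner_conj -{2}(tpermR a b) (inj_eq perm_inj).
Qed.

Lemma card_partner h a : a != h -> (#|[pred s | mt s h == a]| * l.-1)%N = N.
Proof.
move=> ah; rewrite -[RHS]sum1_card (partition_big (mt ^~ h) (predC1 h)) /=; last first.
  by move=> s _; exact: partner_neq.
rewrite (eq_bigr (fun=> #|[pred s | mt s h == a]|)) => [|b bh]; last first.
  by rewrite sum1_card (card_partner_sym ah bh).
by rewrite sum_nat_const mulnC cardC1 card_ord.
Qed.

(** It suffices to find a relabelling that fixes [h] and [h'] and sends [g] to [a] and [g'] to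
    [b]. *)
Lemma card_partner2_sym h h' a b g g' :
  uniq [:: h; h'; a; b] -> uniq [:: h; h'; g; g'] ->
  #|[pred s | (mt s h == a) && (mt s h' == b)]|
  = #|[pred s | (mt s h == g) && (mt s h' == g')]|.
Proof.
rewrite /= !inE !negb_or !andbT => /andP[/and3P[hh' ha hb] /andP[/andP[h'a h'b] ab]].
move=> /andP[/and3P[_ hg hg'] /andP[/andP[h'g h'g'] gg']].
(* [x] is where the first transposition leaves [g']; the second one moves it to [b] without
   disturbing [a]. *)
pose x := tperm g a g'.
have xa : x != a by rewrite -(tpermL g a) (inj_eq perm_inj) eq_sym.
have fx z : z != g -> z != a -> tperm g a z = z.
  by move=> zg za; rewrite tpermD // eq_sym.
have hx : h != x by rewrite -(fx h) // (inj_eq perm_inj).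
have h'x : h' != x by rewrite -(fx h') // (inj_eq perm_inj).
pose t := (tperm g a * tperm x b)%g.
have th : t h = h by rewrite permM fx // tpermD // eq_sym.
have th' : t h' = h' by rewrite permM fx // tpermD // eq_sym.
have tg : t g = a by rewrite permM tpermL tpermD // eq_sym.
have tg' : t g' = b by rewrite permM -/x tpermL.
rewrite -!sum1_card (reindex_inj (mulIg t)) /=.
apply: eq_bigl => s; rewrite !unfold_in /=.
rewrite -{1}th -{1}th' !partner_conj -{1}tg -{1}tg'.
by rewrite !(inj_eq perm_inj).
Qed.

Lemma card_predC_uniq (r : seq 'I_l) : uniq r -> #|[predC r]| = (l - size r)%N.
Proof. move=> /card_uniqP <-; have e : (#|r| + #|[predC r]|)%N = l.
  by rewrite -[RHS]card_ord; exact: cardC.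
by rewrite -[X in (X - _)%N]e addKn.
Qed.

Lemma card_partner2 h h' g g' : uniq [:: h; h'; g; g'] ->
  (#|[pred s | (mt s h == g) && (mt s h' == g')]| * ((l - 2) * (l - 3)) <= N)%N.
Proof.
move=> u; have hh' : uniq [:: h; h'] by move: u; rewrite /= !inE !negb_or; case: (h == h').
set C := #|_|.
have -> : (C * ((l - 2) * (l - 3)) =
  \sum_(a in [predC [:: h; h']]) \sum_(b in [predC [:: h; h'; a]])
     #|[pred s | (mt s h == a) && (mt s h' == b)]|)%N.
  rewrite mulnC -mulnA -(card_predC_uniq hh') -sum_nat_const.
  apply: eq_bigr => a; rewrite inE => ah.
  have ua : uniq [:: h; h'; a].
    move: ah hh'; rewrite /= !inE !negb_or !andbT ![a == _]eq_sym.
    by move=> /andP[-> ->] ->.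
  rewrite -(card_predC_uniq ua) -sum_nat_const.
  apply: eq_bigr => b; rewrite inE => bh.
  apply: card_partner2_sym => //.
  move: bh ua; rewrite /= !inE !negb_or !andbT ![b == _]eq_sym.
  by move=> /and3P[-> -> ->] /andP[/andP[-> ->] ->].
(* Grouping all permutations by the two partners gives the same sum over a larger range, hence only
   an inequality: pairings that match [h] with [h'] are lost. *)
rewrite -[leqRHS]sum1_card (partition_big (mt ^~ h) xpredT) //=.
rewrite [leqLHS]big_mkcond; apply: leq_sum => a _; case: ifP => // _.
rewrite (partition_big (mt ^~ h') xpredT) //=.
rewrite [leqLHS]big_mkcond; apply: leq_sum => b _; case: ifP => // _.
by rewrite sum1_card.
Qed.

End PairingCounts.

(** * Variance of a weighted sum over partners *)

Section SecondMoment.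
Variables (R : realType) (n : nat) (d : 'I_n -> nat).
Local Notation l := (nhalf d).
Hypothesis l_even : ~~ odd l.
Local Notation N := (#|{perm 'I_l}|%:R : R).
Local Notation mt := (partner l_even).
Implicit Types (s t : {perm 'I_l}) (g h a b : 'I_l).
Variable f : 'I_l -> R.
Hypotheses (f_ge0 : forall g, 0 <= f g) (f_le1 : forall g, f g <= 1).
Let F := \sum_g f g.
Hypothesis l_ge10 : (10 <= l)%N.
Let x : R := l%:R.

Let x_ge10 : 10 <= x. Proof. by rewrite ler_nat. Qed.

Let card_partnerR h a : a != h ->
  (#|[pred s | mt s h == a]|%:R : R) = N / (x - 1).
Proof.
move=> ah; rewrite -(card_partner l_even ah) natrM -subn1 natrB; last by lia.
by rewrite -/x mulfK //; have := x_ge10; lra.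
Qed.

Let card_partner2R h h' g g' : uniq [:: h; h'; g; g'] ->
  (#|[pred s | (mt s h == g) && (mt s h' == g')]|%:R : R) <= N / ((x - 2) * (x - 3)).
Proof.
move=> /(card_partner2 l_even); rewrite -(ler_nat R) !natrM !natrB; try lia.
by rewrite ler_pdivlMr //; have := x_ge10; nra.
Qed.

(** The partner of [h] is uniform over the other half-edges; excluding [h] itself costs
    [f h <= 1]. *)
Lemma partner_first_moment h : N * ((F - 1) / (x - 1)) <= \sum_s f (mt s h).
Proof.
rewrite (partition_big (mt ^~ h) (predC1 h)) /=; last first.
  by move=> s _; exact: partner_neq.
rewrite (eq_bigr (fun g => N / (x - 1) * f g)) => [|g gh]; last first.
  rewrite (eq_bigr (fun=> f g)) => [|s /eqP -> //].
  by rewrite sumr_const -[LHS]mulr_natl (card_partnerR gh).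
rewrite -mulr_sumr [leRHS]mulrAC -mulrA ler_wpM2l // ler_wpM2r //.
  by rewrite invr_ge0; have := x_ge10; lra.
by rewrite /F (bigD1 h) //= lerBlDr addrC lerD.
Qed.

(** If [h] and [h'] are matched together, bound the product by 1. Otherwise the two partners
    complete four distinct half-edges, and [card_partner2R] applies. *)
Lemma partner_mixed_moment h h' : h != h' ->
  \sum_s f (mt s h) * f (mt s h') <=
  N * ((x - 1)^-1 + F ^+ 2 / ((x - 2) * (x - 3))).
Proof.
move=> hh'; rewrite (bigID (fun s => mt s h == h')) /= mulrDr lerD //.
  rewrite -(@card_partnerR h h'); last by rewrite eq_sym.
  rewrite -sum1_card natr_sum; apply: ler_sum => s _.
  by rewrite mulr_ile1.
rewrite (partition_big (fun s => (mt s h, mt s h'))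
           (fun p => uniq [:: h; h'; p.1; p.2])) /=; last first.
  move=> s sh; rewrite !inE !negb_or !andbT hh' /=.
  rewrite (inj_eq (inv_inj (partnerK l_even s))) hh' ![h == _]eq_sym ![h' == _]eq_sym.
  rewrite !partner_neq sh !andbT /=.
  by apply: contraNneq sh => e; rewrite -e partnerK.
rewrite mulrA mulrAC.
rewrite /F expr2 big_distrlr /= pair_bigA /= mulr_sumr [leLHS]big_mkcond /=.
(* Pairs violating distinctness add nonnegative terms on the right, which completes the sum to
   [F ^+ 2]. *)
apply: ler_sum => -[g g'] _ /=; case: ifP => u; last first.
  rewrite mulr_ge0 ?mulr_ge0 // invr_ge0.
  by have := x_ge10; nra.
rewrite (eq_bigr (fun=> f g * f g')) => [|s /andP[_ /eqP [-> ->]] //].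
rewrite sumr_const -[leLHS]mulr_natl ler_wpM2r ?mulr_ge0 //.
apply: le_trans (card_partner2R u); rewrite ler_nat.
apply: subset_leq_card; apply/fintype.subsetP => s; rewrite !unfold_in /=.
by move=> /andP[_ /eqP [-> ->]]; rewrite !eqxx.
Qed.

Variable V : pred 'I_l.
Let m : R := #|V|%:R.
Let mu := F / (x - 1).
Let S s := \sum_(h | V h) f (mt s h).

Lemma F_bounds : 0 <= F <= x.
Proof.
rewrite sumr_ge0 //= /x -[l]card_ord -sum1_card natr_sum.
exact: ler_sum.
Qed.

(** The centre [m * mu] only approximates the mean of [S]. In the expanded square the diagonal costs
    [N * m], and the rest is the mixed moment. *)
Lemma partner_sum_variance :
  \sum_s (S s - m * mu) ^+ 2 <= N * (m + m ^+ 2 * (20 / x)).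
Proof.
set B := (x - 1)^-1 + F ^+ 2 / ((x - 2) * (x - 3)).
have x10 := x_ge10.
have /andP[F0 Fx] := F_bounds.
have B0 : 0 <= B.
  by rewrite addr_ge0 ?invr_ge0 ?divr_ge0 ?sqr_ge0 //; nra.
have N0 : 0 <= N by [].
have m0 : 0 <= m by [].
have mE : m = \sum_(h | V h) 1 by rewrite /m -sum1_card natr_sum.
have S1 : m * (N * ((F - 1) / (x - 1))) <= \sum_s S s.
  rewrite exchange_big /= mE mulr_suml; apply: ler_sum => h _.
  by rewrite mul1r partner_first_moment.
have S2 : \sum_s S s ^+ 2 <= m * (N + m * (N * B)).
  rewrite (eq_bigr (fun s => \sum_(h | V h) \sum_(h' | V h') f (mt s h) * f (mt s h'))).
    rewrite exchange_big /= {1}mE mulr_suml; apply: ler_sum => h Vh.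
    rewrite mul1r exchange_big /= (bigD1 h) //= lerD //.
      rewrite -sumr_const; apply: ler_sum => s _; exact: mulr_ile1.
    rewrite mE mulr_suml [leRHS](bigD1 h) //= -[leLHS]add0r; apply: lerD.
      by rewrite mul1r mulr_ge0.
    apply: ler_sum => h' /andP[_ h'h]; rewrite mul1r; apply: partner_mixed_moment.
    by rewrite eq_sym.
  by move=> s _; rewrite expr2 big_distrlr.
have -> : \sum_s (S s - m * mu) ^+ 2 =
    \sum_s S s ^+ 2 - 2 * (m * mu) * \sum_s S s + N * (m * mu) ^+ 2.
  have -> : N * (m * mu) ^+ 2 = \sum_(s : {perm 'I_l}) (m * mu) ^+ 2.
    by rewrite sumr_const -[RHS]mulr_natl.
  rewrite mulr_sumr -sumrB -big_split /=.
  by apply: eq_bigr => s _; ring.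
have mu0 : 0 <= mu by rewrite divr_ge0 //; lra.
(* The cross term has a minus sign, so a lower bound on the first moment is what is needed; its
   deficit produces the term [2 * F / (x - 1) ^+ 2]. *)
have S1' := ler_wpM2l (mulr_ge0 m0 mu0) S1.
suff key : B - mu ^+ 2 + 2 * F / (x - 1) ^+ 2 <= 20 / x.
  have := ler_wpM2l (mulr_ge0 N0 (sqr_ge0 m)) key.
  have -> : N * m ^+ 2 * (B - mu ^+ 2 + 2 * F / (x - 1) ^+ 2) =
     m * (m * (N * B)) - 2 * (m * mu * (m * (N * ((F - 1) / (x - 1))))) + N * (m * mu) ^+ 2.
    by rewrite /mu; field; lra.
  by lra.
by have := variance_error_le x10 F_bounds; rewrite /B /mu.
Qed.

(** Chebyshev's inequality: [S s <= m * t] lies at least [m * t] below the centre [m * mu]. *)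
Lemma card_partner_sum_small (t : R) : 0 < t -> 2 * t <= mu -> 0 < m ->
  #|[pred s | S s <= m * t]|%:R <= N * ((m^-1 + 20 / x) / t ^+ 2).
Proof.
move=> t0 tmu m0.
have mt0 : 0 < (m * t) ^+ 2 by rewrite exprn_gt0 // mulr_gt0.
rewrite -(ler_pM2r mt0).
have -> : N * ((m^-1 + 20 / x) / t ^+ 2) * (m * t) ^+ 2 = N * (m + m ^+ 2 * (20 / x)).
  by field; have := x_ge10; lra.
apply: le_trans partner_sum_variance.
rewrite -sum1_card natr_sum mulr_suml [leLHS]big_mkcond; apply: ler_sum => s _.
case: ifP => [|_]; last exact: sqr_ge0.
rewrite unfold_in /= mul1r => Ss.
have : m * (2 * t) <= m * mu by rewrite ler_pM2l.
by have := mulr_gt0 m0 t0; nra.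
Qed.

End SecondMoment.

Local Open Scope classical_set_scope.
Local Open Scope ring_scope.

(** * Lower bound for the tail on the graph *)

Section LowerBound.
Variables (R : realType).

(** Exchange the sums and fix the root: one of degree above [b] keeps a proportion at least
    [1 - eps] of the pairings, and the others are discarded. *)
Lemma probPR_ge_probDeg n (d : 'I_n -> nat) (c b k eps : R) :
  (forall v, b < (d v)%:R ->
    #|[pred s : {perm 'I_(nhalf d)} | pagerank c s 0 v <= k]|%:R
      <= #|{perm 'I_(nhalf d)}|%:R * eps) ->
  (1 - eps) * probDeg d b <= probPR d c k.
Proof.
move=> bad; rewrite probDegE /probPR natrM invfM !mulrA ler_wpM2r ?invr_ge0 //.
set N := _%:R in bad *.
have N0 : 0 < N by rewrite ltr0n (cardD1 1%g).
rewrite ler_pdivlMr // exchange_big /= mulr_sumr mulr_suml; apply: ler_sum => v _.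
case: ifPn => [/bad {}bad|_]; last by rewrite mulr0 mul0r; apply: sumr_ge0 => s _; case: ifP.
have -> : \sum_(s : {perm 'I_(nhalf d)}) (if k < pagerank c s 0 v then 1 else 0)
    = N - #|[pred s : {perm 'I_(nhalf d)} | pagerank c s 0 v <= k]|%:R :> R.
  rewrite /N -!sum1_card !natr_sum [X in _ - X]big_mkcond -sumrB.
  apply: eq_bigr => s _; rewrite unfold_in /= leNgt.
  by case: ifP; rewrite ?subr0 ?subrr.
lra.
Qed.

Lemma meanDeg_ge1 n (d : 'I_n.+1 -> nat) :
  (forall i, (0 < d i)%N) -> (1 : R) <= meanDeg R d.
Proof.
move=> d0; rewrite /meanDeg ler_pdivlMr ?ltr0n // mul1r ler_nat.
rewrite /nhalf -[X in (X <= _)%N]card_ord -sum1_card.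
by apply: leq_sum.
Qed.

Lemma meanDeg_lim_ge1 (d : forall n, 'I_n -> nat) (ED : R) :
  (forall n (i : 'I_n), (0 < d n i)%N) ->
  (fun n => meanDeg R (d n)) @ \oo --> ED -> 1 <= ED.
Proof.
move=> d0 dED; apply: (cvgr_to_ge dED).
(* The bound starts at [n = 1], because [meanDeg] is 0 at [n = 0] by the division convention. *)
by exists 1%N => // -[|n] //= _; exact: meanDeg_ge1.
Qed.

Lemma sum_inv_degree n (d : 'I_n -> nat) : (forall i, (0 < d i)%N) ->
  \sum_(h : 'I_(nhalf d)) (d (own h))%:R^-1 = n%:R :> R.
Proof.
move=> d0; rewrite (@sum_own n d R (fun i => (d i)%:R^-1)).
rewrite (_ : n%:R = \sum_(i < n) 1 :> R); last by rewrite sumr_const card_ord.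
by apply: eq_bigr => i _; rewrite -[LHS]mulr_natr mulVf // pnatr_eq0 -lt0n.
Qed.

Lemma card_small_pagerank n (d : 'I_n -> nat) (c ED k eps : R) (v : 'I_n) :
  (forall i, (0 < d i)%N) -> ~~ odd (nhalf d) -> 0 < c < 1 ->
  (10 <= n)%N -> 0 < ED -> meanDeg R d <= 2 * ED ->
  4 * ED * k <= c * (1 - c) * (d v)%:R ->
  (((d v)%:R)^-1 + 20 / n%:R) * (4 * ED) ^+ 2 <= eps ->
  #|[pred s : {perm 'I_(nhalf d)} | pagerank c s 0 v <= k]|%:R <= #|{perm 'I_(nhalf d)}|%:R * eps.
Proof.
move=> d0 even c01 n10 ED0 mean kd small.
have /andP[c0 c1] := c01.
have n0 : (0 : R) < n%:R by rewrite ltr0n; lia.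
have nl : (n <= nhalf d)%N.
  by rewrite /nhalf -[X in (X <= _)%N]card_ord -sum1_card; apply: leq_sum.
have l10 : (10 <= nhalf d)%N by exact: leq_trans nl.
have nlR : (n%:R : R) <= (nhalf d)%:R by rewrite ler_nat.
(* The ratio [n / l] is at least [1 / (2 * ED)]; [t] is half of that bound. *)
pose t : R := (4 * ED)^-1.
have t0 : 0 < t by rewrite invr_gt0 mulr_gt0.
pose f (h : 'I_(nhalf d)) : R := (d (own h))%:R^-1.
have f0 g : 0 <= f g by rewrite invr_ge0.
have f1 g : f g <= 1 by rewrite invf_le1 ?ltr0n // ler1n.
have md : #|[pred h : 'I_(nhalf d) | own h == v]| = d v by exact: card_own.
have tmu : 2 * t <= (\sum_g f g) / ((nhalf d)%:R - 1).
  rewrite sum_inv_degree // ler_pdivlMr; last by rewrite subr_gt0 ltr1n; lia.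
  apply: (@le_trans _ _ (2 * t * (nhalf d)%:R)).
    by rewrite ler_wpM2l ?mulr_ge0 ?ltW //; lra.
  have := mean; rewrite /meanDeg ler_pdivrMr // => mean'.
  have -> : n%:R = 2 * t * (2 * ED * n%:R) :> R by rewrite /t; field; lra.
  by rewrite ler_wpM2l // mulr_ge0 ?ltW.
have := @card_partner_sum_small R n d even f f0 f1 l10 [pred h | own h == v] t t0 tmu.
rewrite md ltr0n => /(_ (d0 v)) bound.
apply: (le_trans _ (le_trans bound _)).
  rewrite ler_nat; apply: subset_leq_card; apply/fintype.subsetP => s; rewrite !unfold_in /= => Rk.
  have := le_trans (pagerank_ge_neighbours d0 even c01 s v) Rk.
  set S := \sum_(h | _) _ => Sk.
  change (S <= (d v)%:R * t).
  rewrite ler_pdivlMr; last by rewrite mulr_gt0.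
  have cc : 0 < c * (1 - c) by rewrite mulr_gt0 // subr_gt0.
  rewrite -(ler_pM2l cc); apply: le_trans kd.
  by rewrite mulrA [leRHS]mulrC ler_wpM2r // mulr_ge0 // ltW.
(* The error [20 / l] is weakened to [20 / n] by [n <= l]. *)
rewrite ler_wpM2l //; apply: le_trans small.
rewrite /t exprVn invrK ler_wpM2r ?sqr_ge0 // lerD2l ler_wpM2l //.
by rewrite lef_pV2 // posrE (lt_le_trans n0).
Qed.

Lemma probPR_lower (d : forall n, 'I_n -> nat) (ED c beta eps : R) :
  (forall n (i : 'I_n), (0 < d n i)%N) ->
  (forall n, ~~ odd (nhalf (d n))) ->
  (fun n => meanDeg R (d n)) @ \oo --> ED -> 0 < c < 1 ->
  4 * ED / (c * (1 - c)) < beta -> 0 < eps ->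
  exists K : R, forall k : R, K <= k ->
    exists N : nat, forall n : nat, (N <= n)%N ->
      (1 - eps) * probDeg (d n) (beta * k) <= probPR (d n) c k.
Proof.
move=> d0 even dED c01 hb e0; have /andP[c_gt0 c1] := c01.
have ED1 := meanDeg_lim_ge1 d0 dED.
have cc : 0 < c * (1 - c) by rewrite mulr_gt0 // subr_gt0.
have b0 : 0 < beta by apply: lt_trans hb; rewrite divr_gt0 //; lra.
pose M := (4 * ED) ^+ 2.
have M0 : 0 < M by rewrite exprn_gt0; lra.
(* [K] brings the degree term [M / d_v] below [eps / 2] for every root with [d_v > beta * k]; [N2]
   below does the same for [20 * M / n]. *)
pose K := 2 * M / (beta * eps).
have K0 : 0 < K by apply: divr_gt0; apply: mulr_gt0 => //; lra.
exists K => k Kk; have k0 : 0 < k by exact: lt_le_trans Kk.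
have mean_near : \forall n \near \oo, meanDeg R (d n) <= 2 * ED.
  have EDlt : ED < 2 * ED by lra.
  exact: cvgr_le dED _ EDlt.
have [N1 _ HN1] := mean_near.
pose N2 := Num.truncn (40 * M / eps).
exists (maxn N1 (maxn 10 N2.+1)) => n; rewrite !geq_max => /and3P[nN1 n10 nN2].
apply: probPR_ge_probDeg => v kv.
apply: (card_small_pagerank (ED := ED)) => //; first lra.
- exact: HN1.
- have := hb; rewrite ltr_pdivrMr // => hb'.
  apply: (@le_trans _ _ (beta * (c * (1 - c)) * k)).
    by rewrite ler_wpM2r // ltW.
  by rewrite -mulrA mulrCA ler_pM2l // ltW.
have dv : ((d n v)%:R)^-1 * M <= eps / 2 :> R.
  have bk0 : 0 < beta * k by rewrite mulr_gt0.
  apply: (@le_trans _ _ ((beta * k)^-1 * M)).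
    have dv0 := lt_trans bk0 kv.
    by rewrite ler_pM2r // lef_pV2 ?posrE // ltW.
  rewrite mulrC ler_pdivrMr //.
  have := Kk; rewrite /K ler_pdivrMr ?mulr_gt0 //; lra.
have nn : 20 / n%:R * M <= eps / 2.
  have nM : 40 * M / eps < n%:R.
    by apply: lt_le_trans (truncnS_gt _) _; rewrite ler_nat.
  have n0 : (0 : R) < n%:R by rewrite ltr0n; lia.
  rewrite mulrAC ler_pdivrMr //.
  by move: nM; rewrite ltr_pdivrMr //; lra.
by rewrite mulrDl -/M; lra.
Qed.

End LowerBound.

(** * The branching-process tree *)

Section TreeWalks.
Variables (R : realType) (X : seq nat -> nat) (c : R).
Hypothesis c01 : 0 < c < 1.

Lemma walkw_ge0 s v : 0 <= walkw R X s v.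
Proof.
elim: s v => [|s IH] v //=; rewrite addr_ge0 //.
  by apply: sumr_ge0 => i _; rewrite divr_ge0.
by case: v => // i v; rewrite divr_ge0.
Qed.

(** By induction each neighbour contributes at most 1, and [v] has [tdeg X v] neighbours. A positive
    root degree makes all degrees positive. *)
Lemma walkw_le_tdeg s v : (0 < X [::])%N -> walkw R X s v <= (tdeg X v)%:R.
Proof.
move=> X0; have tdeg_gt0 u : (0 < tdeg X u)%N by case: u.
elim: s v => [|s IH] v /=; first by rewrite ler1n.
have ratio u : walkw R X s u / (tdeg X u)%:R <= 1.
  by rewrite ler_pdivrMr ?ltr0n // mul1r.
have children : \sum_(i < X v) walkw R X s (nat_of_ord i :: v)
    / (tdeg X (nat_of_ord i :: v))%:R <= (X v)%:R.
  rewrite -[in leRHS](card_ord (X v)) -sum1_card natr_sum.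
  by apply: ler_sum => i _; exact: ratio.
case: v children => [|i v] children; first by rewrite addr0.
by rewrite -natr1 lerD.
Qed.

Let term s : \bar R := ((1 - c) * c ^+ s * walkw R X s [::])%:E.

Let term_ge0 s : (0 <= term s)%E.
Proof.
have /andP[/ltW ? /ltW ?] := c01.
by rewrite lee_fin !mulr_ge0 ?subr_ge0 ?exprn_ge0 ?walkw_ge0.
Qed.

Lemma rootPR_le : (0 < X [::])%N -> (rootPR X c <= (X [::])%:R%:E)%E.
Proof.
move=> X0; have /andP[c0 c1] := c01.
apply: lime_le; first by apply: is_cvg_nneseries => s _ _; exact: term_ge0.
apply: nearW => n; rewrite sumEFin lee_fin.
apply: (@le_trans _ _ (\sum_(0 <= s < n) (1 - c) * c ^+ s * (X [::])%:R)).
  apply: ler_sum => s _; rewrite ler_wpM2l ?(walkw_le_tdeg s [::]) //.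
  by rewrite mulr_ge0 ?exprn_ge0 ?subr_ge0 ?ltW.
(* The geometric weights sum to [1 - c ^+ n]. *)
rewrite -mulr_suml -mulr_sumr ler_piMl // big_mkord -opprB mulNr -subrX1 opprB.
by rewrite gerBl exprn_ge0 // ltW.
Qed.

(** Truncate the nonnegative series after [s = 1] and drop the term [s = 0]. *)
Lemma rootPR_ge :
  ((c * (1 - c) * \sum_(i < X [::]) (X [:: nat_of_ord i]).+1%:R^-1)%:E
    <= rootPR X c)%E.
Proof.
apply: le_trans (@nneseries_lim_ge _ _ xpredT 0 2 (fun s _ _ => term_ge0 s)).
rewrite !big_nat_recr //= big_geq // add0e -[leLHS]add0e leeD //.
rewrite lee_fin expr1 [(1 - c) * c]mulrC /= addr0.
by under [in leRHS]eq_bigr do rewrite mul1r.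
Qed.

End TreeWalks.

(** * Measurability of the root-PageRank *)

Section TreeMeasurability.
Variables (R : realType) (dsp : measure_display) (T : measurableType dsp).

(** Splitting over the countably many values of [N] handles sums whose range is random, as in
    [walkw]. *)
Lemma measurable_fun_nat_cases (N : T -> nat) (g : nat -> T -> R) :
  (forall k, measurable (N @^-1` [set k])) ->
  (forall k, measurable_fun setT (g k)) ->
  measurable_fun setT (fun w => g (N w) w).
Proof.
move=> mN mg _ Y mY; rewrite setTI.
have -> : (fun w => g (N w) w) @^-1` Y
    = \bigcup_k (N @^-1` [set k] `&` (setT `&` g k @^-1` Y)).
  apply/seteqP; split => [w Yw|w [k _ [/= <- [_ Yw]]]] //.
  by exists (N w).
by apply: bigcup_measurable => k _; apply: measurableI => //; exact: mg.
Qed.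

Variable X : seq nat -> T -> nat.
Hypothesis mX : forall u k, measurable (X u @^-1` [set k]).

Lemma measurable_walkw s v :
  measurable_fun setT (fun w => walkw R (fun u => X u w) s v).
Proof.
have mtdeg u : measurable_fun setT (fun w => (tdeg (fun u => X u w) u)%:R^-1 : R).
  case: u => [|i u] /=.
    exact: (measurable_fun_nat_cases (mX [::]) (g := fun k _ => k%:R^-1)).
  exact: (measurable_fun_nat_cases (mX (i :: u)) (g := fun k _ => k.+1%:R^-1)).
elim: s v => [|s IH] v /=; first exact: measurable_cst.
apply: measurable_funD.
  apply: (measurable_fun_nat_cases (mX v)
    (g := fun k w => \sum_(i < k) walkw R (fun u => X u w) s (nat_of_ord i :: v)
       / (tdeg (fun u => X u w) (nat_of_ord i :: v))%:R)) => k.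
  by apply: measurable_sum => i; apply: measurable_funM.
by case: v => [|i v]; [exact: measurable_cst | exact: measurable_funM].
Qed.

Lemma measurable_rootPR (c : R) : 0 < c < 1 ->
  measurable_fun setT (fun w => rootPR (fun u => X u w) c).
Proof.
move=> c01; have /andP[/ltW c0 /ltW c1] := c01.
apply: ge0_emeasurable_sum => s.
  move=> w _ _; rewrite lee_fin !mulr_ge0 ?subr_ge0 ?exprn_ge0 //.
  exact: walkw_ge0.
move=> _; apply/measurable_EFinP; apply: measurable_funM => //.
exact: measurable_walkw.
Qed.

Lemma measurable_rootPR_gt (c k : R) : 0 < c < 1 ->
  measurable [set w | (k%:E < rootPR (fun u => X u w) c)%E].
Proof.
move=> c01; rewrite -[X in measurable X]setTI.
by apply: emeasurable_fun_o_infty => //; exact: measurable_rootPR.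
Qed.

End TreeMeasurability.

(** * A first-moment lower bound for the probability of an event *)

Section ReverseMarkov.
Variables (R : realType) (dsp : measure_display) (T : measurableType dsp).
Variable P : probability T R.

(** Integrate the pointwise bound. In the application at most [r] of the events [B i] occur on [A]
    outside [G], and trivially at most [m] on [G]. *)
Lemma reverse_markov m (A G : set T) (B : nat -> set T) (r : R) : 0 <= r ->
  measurable A -> measurable G -> (forall i, measurable (B i)) ->
  (forall w, \sum_(i < m) \1_(B i) w <= r * \1_A w + m%:R * \1_G w) ->
  (\sum_(i < m) P (B i) <= r%:E * P A + m%:R%:E * P G)%E.
Proof.
move=> r0 mA mG mB H.
have mI (C : set T) (mC : measurable C) : measurable_fun setT (fun w => (\1_C w : R)%:E).
  by apply/measurable_EFinP; exact: measurable_indic.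
have mZ (C : set T) (k : R) (mC : measurable C) :
    measurable_fun setT (fun w => (k * \1_C w : R)%:E).
  by apply/measurable_EFinP/measurable_funM => //; exact: measurable_indic.
have -> : (\sum_(i < m) P (B i) = \int[P]_w (\sum_(i < m) (\1_(B i) w : R)%:E))%E.
  rewrite ge0_integral_sum //; last by move=> i; exact: mI.
  by apply: eq_bigr => i _; rewrite integral_indic // setIT.
have -> : (r%:E * P A + m%:R%:E * P G
    = \int[P]_w ((r * \1_A w)%:E + (m%:R * \1_G w)%:E))%E.
  rewrite ge0_integralD //; first last.
  - exact: mZ.
  - exact: mZ.
  - by move=> w _; rewrite lee_fin mulr_ge0.
  rewrite (integralZl_indic measurableT (fun=> A)) //; last by move/lt_geF; rewrite r0.
  rewrite (integralZl_indic measurableT (fun=> G)) //; last by move/lt_geF; rewrite ler0n.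
  by rewrite !integral_indic // !setIT.
apply: ge0_le_integral => //.
- by move=> w _; apply: sume_ge0 => i _; rewrite lee_fin.
- by apply: emeasurable_sum => i; exact: mI.
- by apply: emeasurable_funD; exact: mZ.
- by move=> w _; rewrite sumEFin -EFinD lee_fin.
Qed.

End ReverseMarkov.

(** * Tail bounds for the root-PageRank of the tree *)

Section TreeTail.
Variables (R : realType) (dsp : measure_display) (T : measurableType dsp).
Variables (P : probability T R) (X : seq nat -> T -> nat) (p : nat -> R) (ED c : R).
Hypotheses (tree : UBP_tree P X p ED) (c01 : 0 < c < 1) (p0 : p 0%N = 0).

Let mX u k : measurable (X u @^-1` [set k]). Proof. by case: tree. Qed.
Let PX0 k : P (X [::] @^-1` [set k]) = (p k)%:E. Proof. by case: tree. Qed.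

Let tail_bigcup (x : R) : [set w | x < (X [::] w)%:R]
  = \bigcup_(k in [set k : nat | x < k%:R]) X [::] @^-1` [set k].
Proof.
by apply/seteqP; split => [w xw|w [k /= xk wk]]; [exists (X [::] w) | rewrite wk].
Qed.

Lemma root_degree_tail (x t : R) :
  (fun N => \sum_(k < N | x < k%:R) p k) @ \oo --> t ->
  P [set w | x < (X [::] w)%:R] = t%:E.
Proof.
move=> xt; rewrite tail_bigcup.
rewrite measure_bigcup //; last by move=> i j _ _ [w [/= <- ->]].
apply/cvg_lim => //; rewrite (_ : (fun n => _) =
    EFin \o (fun N => \sum_(k < N | x < k%:R) p k)).
  by apply/fine_cvgP; split; [exact: nearW | exact: xt].
apply/funext => N /=; rewrite big_mkord -sumEFin.
apply: eq_big => [k|k _]; first by apply/idP/idP; rewrite inE.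
exact: PX0.
Qed.

Let G k := [set w | (k%:E < rootPR (fun u => X u w) c)%E].

Let mG k : measurable (G k). Proof. exact: measurable_rootPR_gt. Qed.

Let mTail (x : R) : measurable [set w | x < (X [::] w)%:R].
Proof.
by rewrite tail_bigcup; exact: bigcup_measurable.
Qed.

Lemma rootPR_tail_le (k t : R) :
  (fun N => \sum_(i < N | k < i%:R) p i) @ \oo --> t -> (P (G k) <= t%:E)%E.
Proof.
move=> /root_degree_tail <-.
(* [rootPR_le] requires a child at the root, so the null event of a childless root is adjoined. *)
apply: (@le_trans _ _ (P (X [::] @^-1` [set 0%N] `|` [set w | k < (X [::] w)%:R]))).
  apply: le_measure; rewrite ?inE //; first exact: measurableU.
  move=> w /= kw; case: (posnP (X [::] w)) => X0; [by left | right].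
  have := lt_le_trans kw (rootPR_le (X := fun u => X u w) c01 X0).
  by rewrite lte_fin.
apply: le_trans (measureU2 _ _ _) _ => //.
by rewrite [X in (X + _)%E]PX0 p0 add0e.
Qed.

Variable j : nat.
Let q : R := j.+1%:R * p j.+1 / ED.
Hypothesis q_gt0 : 0 < q.

(* With [B i] the event that the root has [m] children and the [i]-th of them
   has degree [j + 1], the mean number of such children is [q * m]; when more
   than [q / 2 * m] of them occur, [rootPR_ge] makes the root exceed [k]. *)
Lemma rootPR_tail_degree (k : R) (m : nat) : 0 < k ->
  2 * j.+1%:R / (c * (1 - c) * q) * k < m%:R ->
  ((q / 2 * p m)%:E <= P (G k `&` X [::] @^-1` [set m]))%E.
Proof.
move=> k0 km; have /andP[c0 c1] := c01.
have cc : 0 < c * (1 - c) by rewrite mulr_gt0 // subr_gt0.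
have j0 : (0 : R) < j.+1%:R by rewrite ltr0n.
have m0 : (0 : R) < m%:R.
  by apply: lt_trans km; rewrite mulr_gt0 // divr_gt0 // mulr_gt0.
have r0 : 0 <= q / 2 * m%:R by apply: mulr_ge0 => //; have := ltW q_gt0; lra.
set A := X [::] @^-1` [set m].
pose B i := A `&` X [:: i] @^-1` [set j].
have PB i : P (B i) = (p m * q)%:E.
  case: tree => _ _ PXu indep.
  have := indep [:: [::]; [:: i]] (fun u => if u is [::] then m else j) isT.
  rewrite !big_cons !big_nil /= setIT mule1 => ->.
  by rewrite PX0 PXu.
have mB i : measurable (B i) by apply: measurableI; exact: mX.
have mGA : measurable (G k `&` A) by apply: measurableI; [exact: mG | exact: mX].
have := @reverse_markov _ _ _ P m A (G k `&` A) B (q / 2 * m%:R).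
rewrite [P A]PX0 (eq_bigr (fun=> (p m * q)%:E)) => [|i _]; last exact: PB.
rewrite sumEFin sumr_const card_ord -[(p m * q) *+ m]mulr_natl => bound.
have {bound} : ((m%:R * (p m * q))%:E
    <= (q / 2 * m%:R)%:E * (p m)%:E + m%:R%:E * P (G k `&` A))%E.
  apply: bound => //; first exact: mX.
  move=> w; rewrite !indicE !in_setI.
  have [wA|wA] := boolP (w \in A); last first.
    rewrite andbF !mulr0 addr0 big1 // => i _.
    by rewrite indicE in_setI (negbTE wA).
  rewrite andbT mulr1.
  have le_m : \sum_(i < m) \1_(B i) w <= m%:R :> R.
    rewrite -[m in leRHS]card_ord -sum1_card natr_sum.
    by apply: ler_sum => i _; rewrite indicE; case: (_ \in _).
  have [wG|wG] := boolP (w \in G k).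
    by rewrite mulr1 (le_trans le_m) // lerDr.
  rewrite mulr0 addr0 leNgt; apply: contra wG => many; rewrite inE /G /=.
  apply: lt_le_trans (rootPR_ge (fun u => X u w) c01).
  have -> : X [::] w = m by move: wA; rewrite inE.
  rewrite lte_fin.
  have key : j.+1%:R^-1 * \sum_(i < m) \1_(B i) w
      <= \sum_(i < m) (X [:: nat_of_ord i] w).+1%:R^-1 :> R.
    rewrite mulr_sumr; apply: ler_sum => i _; rewrite indicE.
    have [|_] := boolP (w \in B i); last by rewrite mulr0.
    by rewrite inE => -[_ /= ->]; rewrite mulr1.
  apply: lt_le_trans (ler_wpM2l (ltW cc) key).
  move: km; rewrite mulrAC ltr_pdivrMr; last exact: mulr_gt0 cc q_gt0.
  move=> km.
  rewrite mulrCA ltr_pdivlMl //.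
  have : c * (1 - c) * (q / 2 * m%:R) < c * (1 - c) * \sum_(i < m) \1_(B i) w.
    by rewrite ltr_pM2l.
  lra.
have : P (G k `&` A) \is a fin_num by exact: fin_num_measure.
move=> /fineK <-; rewrite -!EFinM -EFinD !lee_fin => bound.
(* After cancelling [m], the first term absorbs half of the mean [p m * q]. *)
rewrite -(ler_pM2l m0); lra.
Qed.

(** Sum the bounds of [rootPR_tail_degree] over the disjoint events fixing the root degree; every
    partial sum stays below [P (G k)]. *)
Lemma rootPR_tail_ge (k t : R) : 0 < k ->
  (fun N => \sum_(i < N | 2 * j.+1%:R / (c * (1 - c) * q) * k < i%:R) p i) @ \oo --> t ->
  ((q / 2 * t)%:E <= P (G k))%E.
Proof.
move=> k0 kt; set b := 2 * _ / _ in kt.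
have finG : P (G k) \is a fin_num by exact: fin_num_measure.
rewrite -(fineK finG) lee_fin.
apply: (cvgr_to_le (cvgM (cvg_cst (q / 2)) kt)).
apply: nearW => N /=; rewrite -lee_fin (fineK finG).
have triv : trivIset setT (fun m => G k `&` X [::] @^-1` [set m]).
  by move=> m m' _ _ [w [[_ /= <-] [_ /= <-]]].
apply: (@le_trans _ _ (\sum_(0 <= m < N | (b * k < m%:R)%R) P (G k `&` X [::] @^-1` [set m]))%E).
  rewrite big_mkord mulr_sumr -sumEFin; apply: lee_sum => m bm.
  exact: rootPR_tail_degree.
apply: (@le_trans _ _ (\sum_(0 <= m <oo) P (G k `&` X [::] @^-1` [set m]))%E).
  apply: le_trans (nneseries_lim_ge N _) => //.
  by rewrite big_mkcond; apply: lee_sum => m _; case: ifP.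
rewrite (_ : (\sum_(0 <= m <oo) _)%E = P (\bigcup_m (G k `&` X [::] @^-1` [set m]))).
  apply: le_measure; rewrite ?inE //.
    by apply: bigcup_measurable => m _; apply: measurableI; [exact: mG|exact: mX].
  by apply: bigcup_sub => m _ w [].
rewrite measure_bigcup //; first by apply: eq_eseriesl => m; apply/esym/mem_set.
by move=> m _; apply: measurableI; [exact: mG|exact: mX].
Qed.

End TreeTail.

(** * Comparison of the tail at two scales *)

Section TailRatio.
Variables (R : realType) (p : nat -> R) (tau : R) (L : R -> R).
Hypothesis p_ge0 : forall k, 0 <= p k.
Hypothesis p_sum1 : (fun N => \sum_(k < N) p k) @ \oo --> (1 : R).
Hypothesis sv : slowly_varying L.
Hypothesis tail : forall x : R, 0 < x ->
  (fun N => \sum_(k < N | x < k%:R) p k) @ \oo --> L x * x `^ (1 - tau).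
(** As the tail of [p], [t] is at most 1 and nonincreasing, although [L] itself need not be
    monotone. *)
Let t x := L x * x `^ (1 - tau).

Let t_le1 x : 0 < x -> t x <= 1.
Proof.
move=> x0; apply: (ler_cvg_to (tail x0) p_sum1); apply: nearW => N.
by rewrite big_mkcond; apply: ler_sum => k _; case: ifP.
Qed.

Let t_anti x y : 0 < x -> x <= y -> t y <= t x.
Proof.
move=> x0 xy; have y0 := lt_le_trans x0 xy.
apply: (ler_cvg_to (tail y0) (tail x0)); apply: nearW => N.
rewrite big_mkcond [leRHS]big_mkcond; apply: ler_sum => k _.
by case: (ltP y) => [/(le_lt_trans xy) ->|_] //; case: ifP.
Qed.

Let t_gt0 x : 0 < x -> 0 < t x.
Proof. by move=> x0; rewrite mulr_gt0 ?powR_gt0 //; exact: sv.1. Qed.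

(* Slow variation handles large [x]; for small [x] the ratio is at least the
   positive value of the tail at the threshold. *)
Lemma tail_ratio_ge (b : R) : 0 < b ->
  exists2 r : R, 0 < r & forall x, 0 < x ->
    r * (L x * x `^ (1 - tau)) <= L (b * x) * (b * x) `^ (1 - tau).
Proof.
move=> b0; have half : (2^-1 : R) < 1 by lra.
have : \forall x \near +oo, 2^-1 <= L (b * x) / L x.
  exact: cvgr_ge (sv.2 b b0) _ half.
(* The maximum makes the threshold positive and strictly larger than [K0]. *)
move=> [K0 [_ HK0]]; pose K := Num.max 1 (K0 + 1).
have K_gt0 : 0 < K by rewrite lt_max ltr01.
have bp : 0 < b `^ (1 - tau) by exact: powR_gt0.
exists (Num.min (2^-1 * b `^ (1 - tau)) (t (b * K))).
  by rewrite lt_min mulr_gt0 ?t_gt0 ?mulr_gt0 ?invr_gt0.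
move=> x x0; rewrite -/(t x) -/(t (b * x)).
have [xK|Kx] := leP x K.
  apply: (@le_trans _ _ (t (b * K) * 1)).
    apply: ler_pM; rewrite ?t_le1 ?(ltW (t_gt0 x0)) //.
      by rewrite le_min ltW ?mulr_gt0 ?invr_gt0 ?ltW ?t_gt0 ?mulr_gt0.
    by rewrite ge_min lexx orbT.
  by rewrite mulr1 t_anti ?mulr_gt0 // ler_pM2l.
apply: (@le_trans _ _ (2^-1 * b `^ (1 - tau) * t x)).
  by rewrite ler_wpM2r ?(ltW (t_gt0 x0)) // ge_min lexx.
have Lx := sv.1 x x0.
have : 2^-1 <= L (b * x) / L x.
  by apply: HK0; apply: le_lt_trans Kx; rewrite le_max lerDl ler01 orbT.
rewrite ler_pdivlMr // => LL.
have BX : 0 <= b `^ (1 - tau) * x `^ (1 - tau) by rewrite mulr_ge0 ?powR_ge0.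
rewrite /t powRM; [|exact: ltW..].
by rewrite mulrACA; apply: ler_wpM2r BX _ _ LL.
Qed.

End TailRatio.

(** Supplies the child degree used in the tree lower bound; otherwise the total mass would be 0. *)
Lemma pmf_pos_ex (R : realType) (p : nat -> R) :
  (forall k, 0 <= p k) -> p 0%N = 0 ->
  (fun N => \sum_(k < N) p k) @ \oo --> (1 : R) -> exists j, 0 < p j.+1.
Proof.
move=> p_ge0 p0 p1; apply: contrapT => /forallNP np.
have pz k : p k = 0.
  case: k => // k; apply/le_anti; rewrite p_ge0 andbT leNgt; apply/negP; exact: np.
have : (fun N => \sum_(k < N) p k) @ \oo --> (0 : R).
  rewrite (_ : (fun N => _) = cst 0); first exact: cvg_cst.
  by apply/funext => N; rewrite big1.
move=> e; suff : (1 : R) = 0 by apply/eqP; exact: oner_neq0.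
exact: (cvg_unique _ p1 e).
Qed.

Lemma limit_pmf0 (R : realType) (d : forall n, 'I_n -> nat) (p0 : R) :
  (forall n (i : 'I_n), (0 < d n i)%N) ->
  (fun n => pmfDeg R (d n) 0) @ \oo --> p0 -> p0 = 0.
Proof.
move=> d0 dp.
suff dp0 : (fun n => pmfDeg R (d n) 0) @ \oo --> (0 : R)
  by exact: (cvg_unique _ dp dp0).
suff -> : (fun n => pmfDeg R (d n) 0) = cst 0 by exact: cvg_cst.
apply/funext => n; rewrite /pmfDeg card_classical eq_card0 ?mul0r // => i.
by rewrite unfold_in /=; apply/negbTE; rewrite -lt0n.
Qed.

(** The iterated lower limit is unfolded with the denominator multiplied out, since [probDeg] can
    vanish. The constant [a] precedes the probability space, so it serves every realisation of the
    tree. *)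
Theorem mainTheorem6 (R : realType)
  (d : forall n : nat, 'I_n -> nat)   (* degree vectors d_n *)
  (p : nat -> R)                      (* law of D: p k = P(D = k) *)
  (ED : R)                            (* E[D] *)
  (c : R) :
  (forall n (i : 'I_n), (0 < d n i)%N) ->
  (forall n, ~~ odd (nhalf (d n))) ->
  (forall k, 0 <= p k) ->
  (fun N => \sum_(k < N) p k) @ \oo --> (1 : R) ->
  (* D_n -> D in distribution *)
  (forall k, (fun n => pmfDeg R (d n) k) @ \oo --> p k) ->
  (* E[D] = ED < oo and E[D_n] -> E[D] *)
  (fun N => \sum_(k < N) k%:R * p k) @ \oo --> ED ->
  (fun n => meanDeg R (d n)) @ \oo --> ED ->
  0 < c < 1 ->
  [/\ (forall (n : nat) (k : R), probPR (d n) c k <= probDeg (d n) k),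
      (forall beta : R, 4 * ED / (c * (1 - c)) < beta ->
         forall eps : R, 0 < eps ->
         exists K : R, forall k : R, K <= k ->
         exists N : nat, forall n : nat, (N <= n)%N ->
           (1 - eps) * probDeg (d n) (beta * k) <= probPR (d n) c k)
    & (forall (tau : R) (L : R -> R),
         1 < tau -> slowly_varying L ->
         (forall x : R, 0 < x ->
            (fun N => \sum_(k < N | x < k%:R) p k) @ \oo --> L x * x `^ (1 - tau)) ->
         exists a : R, 0 < a <= 1 /\
           forall (dsp : measure_display) (T : measurableType dsp)
                  (P : probability T R) (X : seq nat -> T -> nat),
             UBP_tree P X p ED ->
             forall k : R, 0 < k ->
               ((a * L k * k `^ (1 - tau))%:E
                  <= P [set w | (k%:E < rootPR (fun u => X u w) c)%E]
                /\ P [set w | (k%:E < rootPR (fun u => X u w) c)%E]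
                  <= (L k * k `^ (1 - tau))%:E)%E)].
Proof.
move=> d0 even p_ge0 p_sum1 dp _ dED c01.
have /andP[c_gt0 c1] := c01.
have p0 : p 0%N = 0 := limit_pmf0 d0 (dp 0%N).
have ED1 := meanDeg_lim_ge1 d0 dED.
split.
- by move=> n k; apply: probPR_le_probDeg.
- by move=> beta hb eps e0; apply: (probPR_lower d0 even dED c01 hb e0).
- move=> tau L _ sv tail.
  have [j pj] := pmf_pos_ex p_ge0 p0 p_sum1.
  pose q := j.+1%:R * p j.+1 / ED.
  have q0 : 0 < q by rewrite divr_gt0 ?mulr_gt0 //; lra.
  pose b := 2 * j.+1%:R / (c * (1 - c) * q).
  have b0 : 0 < b.
    have c1' : 0 < 1 - c by rewrite subr_gt0.
    apply: divr_gt0; first by rewrite mulr_gt0 ?ltr0n.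
    exact: mulr_gt0 (mulr_gt0 c_gt0 c1') q0.
  have [r r0 ratio] := tail_ratio_ge p_ge0 p_sum1 sv tail b0.
  (* The factor [q / 2] comes from the first-moment bound at scale [b * k], and [r] compares the
     tail there with the tail at [k]. *)
  exists (Num.min 1 (q / 2 * r)); split.
    by rewrite ge_min lexx lt_min ltr01 mulr_gt0 // divr_gt0.
  move=> dsp T P X tree k k0; split; last exact: (rootPR_tail_le tree c01 p0 (tail k k0)).
  have lb := rootPR_tail_ge tree c01 q0 k0 (tail _ (mulr_gt0 b0 k0)).
  apply: (le_trans _ lb).
  rewrite lee_fin -mulrA.
  have t0 : 0 <= L k * k `^ (1 - tau) by rewrite mulr_ge0 ?powR_ge0 // ltW // sv.1.
  apply: (@le_trans _ _ (q / 2 * r * (L k * k `^ (1 - tau)))).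
    by rewrite ler_wpM2r // ge_min lexx orbT.
  by rewrite -mulrA ler_wpM2l ?ratio // divr_ge0 // ltW.
Qed.
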